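(* Let $\mathcal{V}$ and $\mathcal{W}$ be varieties of $\Omega$-algebras of the same similarity type $\tau\colon\Omega\to\mathbb{N}$ without nullary operation symbols, and let $\Sigma$ be an equational base for $\mathcal{V}$. Then the variety $\mathsf{H}(\mathcal{V}\circ\mathcal{W})$ generated by the Mal'tsev product $\mathcal{V}\circ\mathcal{W}$ is defined by the set of identities $\Sigma^p$; that is, an $\Omega$-algebra belongs to $\mathsf{H}(\mathcal{V}\circ\mathcal{W})$ if and only if it satisfies every identity in $\Sigma^p$.
   Context: Fix a similarity type $\tau\colon\Omega\to\mathbb{N}$ without nullary operation symbols. Algebras are nonempty. Mal'tsev product: $\mathcal{V}\circ\mathcal{W}$ is the class of all $\Omega$-algebras $A$ having a congruence $\theta$ such that $A/\theta\in\mathcal{W}$ and every congruence class of $\theta$ that is a subalgebra of $A$ belongs to $\mathcal{V}$. $\mathsf{H}(\mathcal{K})$ denotes the class of homomorphic images of members of $\mathcal{K}$. Definition of $\Sigma^p$ (relative to $\mathcal{W}$): $\Omega$-terms are elements of the absolutely free $\Omega$-algebra over a countably infinite set of variables. Let $\sigma$ be an identity $u(x_1,\dots,x_k)=v(x_1,\dots,x_k)$ true in $\mathcal{V}$ (not every $x_i$ need occur in $u$ or $v$). Then $\sigma^p$ is the set of all identities $$u(r_1,\dots,r_k)=v(r_1,\dots,r_k)$$ where $r_1,\dots,r_k$ are $\Omega$-terms such that $\mathcal{W}\models r_i=r_j$ for all $1\le i,j\le k$, and $\mathcal{W}\models \omega(r_1,\dots,r_1)=r_1$ for every $\omega\in\Omega$.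 For a set $\Sigma$ of identities true in $\mathcal{V}$, $\Sigma^p:=\bigcup_{\sigma\in\Sigma}\sigma^p$ (possibly empty). An equational base for $\mathcal{V}$ is a set of identities defining $\mathcal{V}$. *)

(* Defs.v *)
From HB Require Import structures.
From mathcomp Require Import all_boot generic_quotient.
From mathcomp Require Import boolp classical_sets.

Set Implicit Arguments.
Unset Strict Implicit.
Unset Printing Implicit Defensive.

Local Open Scope quotient_scope.

Record algebra (Om : Type) (tau : Om -> nat) := Algebra {
  carrier :> Type;
  op : forall o : Om, ('I_(tau o) -> carrier) -> carrier;
  carrier_nonempty : inhabited carrier }.

Arguments op {Om tau} a o _.
Arguments carrier_nonempty {Om tau} a.

(* A class of algebras; not a [set], whose universe would otherwise be forced
   strictly above that of the carriers. *)
Definition algebra_class (Om : Type) (tau : Om -> nat) := algebra tau -> Prop.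

Definition hom (Om : Type) (tau : Om -> nat) (A B : algebra tau) (f : A -> B) :
    Prop :=
  forall o (a : 'I_(tau o) -> A), f (op A o a) = op B o (f \o a).

Definition surjective (S T : Type) (f : S -> T) : Prop :=
  forall y, exists x, f x = y.

Record is_subalgebra (Om : Type) (tau : Om -> nat) (A : algebra tau)
    (S : set A) : Prop := IsSubalgebra {
  subalgebra_nonempty : exists x, S x;
  subalgebra_op : forall o (a : 'I_(tau o) -> A),
    (forall i, S (a i)) -> S (op A o a) }.

Definition subalgebra (Om : Type) (tau : Om -> nat) (A : algebra tau)
    (S : set A) (subS : is_subalgebra S) : algebra tau :=
  @Algebra Om tau {x : A | S x}
    (fun o a => exist S (op A o (fun i => sval (a i)))
                  (subalgebra_op subS (fun i => svalP (a i))))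
    (let: ex_intro x Sx := subalgebra_nonempty subS in
     inhabits (exist S x Sx)).

Lemma product_nonempty (Om : Type) (tau : Om -> nat) (I : Type)
  (A : I -> algebra tau) : inhabited (forall i, A i).
Proof.
have ex i : exists x : A i, True by case: (carrier_nonempty (A i)) => x; exists x.
exact: (inhabits (fun i => projT1 (cid (ex i)))).
Qed.

Definition product (Om : Type) (tau : Om -> nat) (I : Type)
    (A : I -> algebra tau) : algebra tau :=
  @Algebra Om tau (forall i, A i)
    (fun o a i => op (A i) o (fun j => a j i))
    (product_nonempty A).

Record congruence (Om : Type) (tau : Om -> nat) (A : algebra tau) :=
  Congruence {
    cong_rel :> A -> A -> Prop;
    cong_refl : forall x, cong_rel x x;
    cong_sym : forall x y, cong_rel x y -> cong_rel y x;
    cong_trans : forall x y z, cong_rel x y -> cong_rel y z -> cong_rel x z;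
    cong_op : forall o (a b : 'I_(tau o) -> A),
      (forall i, cong_rel (a i) (b i)) -> cong_rel (op A o a) (op A o b) }.

Definition cong_relb (Om : Type) (tau : Om -> nat) (A : algebra tau)
  (theta : congruence A) : rel {classic A} := fun x y => `[< theta x y >].

Lemma cong_relb_refl (Om : Type) (tau : Om -> nat) (A : algebra tau)
  (theta : congruence A) : reflexive (cong_relb theta).
Proof. by move=> x; apply/asboolP/cong_refl. Qed.

Lemma cong_relb_sym (Om : Type) (tau : Om -> nat) (A : algebra tau)
  (theta : congruence A) : symmetric (cong_relb theta).
Proof. by move=> x y; apply/asboolP/asboolP => /cong_sym. Qed.

Lemma cong_relb_trans (Om : Type) (tau : Om -> nat) (A : algebra tau)
  (theta : congruence A) : transitive (cong_relb theta).
Proof.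
by move=> y x z /asboolP xy /asboolP yz; apply/asboolP/(cong_trans xy yz).
Qed.

Definition cong_equiv (Om : Type) (tau : Om -> nat) (A : algebra tau)
    (theta : congruence A) : equiv_rel {classic A} :=
  EquivRel (cong_relb theta) (@cong_relb_refl _ _ A theta)
    (@cong_relb_sym _ _ A theta) (@cong_relb_trans _ _ A theta).

Definition quotient (Om : Type) (tau : Om -> nat) (A : algebra tau)
    (theta : congruence A) : algebra tau :=
  @Algebra Om tau {eq_quot (cong_equiv theta)}
    (fun o a => \pi_({eq_quot (cong_equiv theta)})
                  (op A o (fun i => repr (a i) : A)))
    (let: inhabits x := carrier_nonempty A in
     inhabits (\pi_({eq_quot (cong_equiv theta)}) (x : {classic A}))).

Definition quotient_proj (Om : Type) (tau : Om -> nat) (A : algebra tau)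
    (theta : congruence A) (x : A) : quotient theta :=
  \pi_({eq_quot (cong_equiv theta)}) (x : {classic A}).

Lemma quotient_projP (Om : Type) (tau : Om -> nat) (A : algebra tau)
    (theta : congruence A) (x y : A) :
  quotient_proj theta x = quotient_proj theta y <-> theta x y.
Proof.
split=> [/eqmodP /asboolP // | xy].
by apply/eqmodP/asboolP.
Qed.

Lemma quotient_proj_surj (Om : Type) (tau : Om -> nat) (A : algebra tau)
  (theta : congruence A) : surjective (quotient_proj theta).
Proof. by move=> y; exists (repr y : A); rewrite /quotient_proj reprK. Qed.

Lemma quotient_proj_hom (Om : Type) (tau : Om -> nat) (A : algebra tau)
  (theta : congruence A) : hom (quotient_proj theta).
Proof.
move=> o a; apply/quotient_projP/cong_op => i.
by apply/quotient_projP; rewrite /quotient_proj reprK.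
Qed.

Definition hom_images (Om : Type) (tau : Om -> nat) (K : algebra_class tau) :
    algebra_class tau :=
  fun A => exists2 B : algebra tau, K B &
    exists f : B -> A, hom f /\ surjective f.

(* Closure under isomorphic copies is part of [variety_H]. *)
Record is_variety (Om : Type) (tau : Om -> nat) (K : algebra_class tau) :
    Prop := IsVariety {
  variety_H : forall A, hom_images K A -> K A;
  variety_S : forall (A : algebra tau) (S : set A) (subS : is_subalgebra S),
    K A -> K (subalgebra subS);
  variety_P : forall (I : Type) (A : I -> algebra tau),
    (forall i, K (A i)) -> K (product A) }.

Definition generated_variety (Om : Type) (tau : Om -> nat)
    (K : algebra_class tau) : algebra_class tau :=
  fun A => forall U : algebra_class tau,
    is_variety U -> (forall B, K B -> U B) -> U A.

(* [Var i] stands for the variable x_(i+1). *)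
Inductive term (Om : Type) (tau : Om -> nat) : Type :=
| Var of nat
| App (o : Om) of ('I_(tau o) -> term tau).

Arguments Var {Om tau} _.
Arguments App {Om tau} o _.

Fixpoint eval (Om : Type) (tau : Om -> nat) (A : algebra tau) (h : nat -> A)
    (t : term tau) : A :=
  match t with
  | Var i => h i
  | App o a => op A o (fun j => eval h (a j))
  end.

Fixpoint subst (Om : Type) (tau : Om -> nat) (r : nat -> term tau)
    (t : term tau) : term tau :=
  match t with
  | Var i => r i
  | App o a => App o (fun j => subst r (a j))
  end.

Fixpoint vars_below (Om : Type) (tau : Om -> nat) (k : nat) (t : term tau) :
    Prop :=
  match t with
  | Var i => (i < k)%N
  | App o a => forall j, vars_below k (a j)
  end.

Record identity (Om : Type) (tau : Om -> nat) :=
  Identity { lhs : term tau; rhs : term tau }.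

Definition satisfies (Om : Type) (tau : Om -> nat) (A : algebra tau)
    (e : identity tau) : Prop :=
  forall h : nat -> A, eval h (lhs e) = eval h (rhs e).

Definition class_satisfies (Om : Type) (tau : Om -> nat)
    (K : algebra_class tau) (e : identity tau) : Prop :=
  forall A, K A -> satisfies A e.

Definition equational_base (Om : Type) (tau : Om -> nat)
    (E : set (identity tau)) (K : algebra_class tau) : Prop :=
  forall A, K A <-> (forall e, E e -> satisfies A e).

Definition maltsev_product (Om : Type) (tau : Om -> nat)
    (V W : algebra_class tau) : algebra_class tau :=
  fun A => exists theta : congruence A,
    W (quotient theta) /\
    forall (x : A) (subC : is_subalgebra [set y | theta x y]),
      V (subalgebra subC).

(* The terms r_1, ..., r_k are r 0, ..., r k.-1; the values of [r] from k on are
   irrelevant. Without nullary symbols, every term contains a variable, so that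
   [vars_below k] forces 0 < k and r 0 is indeed r_1. *)
Definition identity_p (Om : Type) (tau : Om -> nat) (W : algebra_class tau)
    (s : identity tau) : set (identity tau) :=
  [set e | exists (k : nat) (r : nat -> term tau),
    [/\ vars_below k (lhs s) /\ vars_below k (rhs s),
        forall i j, (i < k)%N -> (j < k)%N ->
          class_satisfies W (Identity (r i) (r j)),
        forall o, class_satisfies W (Identity (App o (fun=> r 0)) (r 0)) &
        e = Identity (subst r (lhs s)) (subst r (rhs s))]].

Definition identities_p (Om : Type) (tau : Om -> nat) (W : algebra_class tau)
    (E : set (identity tau)) : set (identity tau) :=
  \bigcup_(s in E) identity_p W s.

(* Main.v *)
(* Suppose A satisfies Sigma^p.  Let T be the absolutely free algebra on the set
   A, and g : T -> G a homomorphism to an algebra G of W whose kernel consists of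
   the identities of W.  The image F of T in A x G maps onto A, and F modulo the
   kernel theta of the second projection lies in W.  A class of theta that is a
   subalgebra consists of values of terms r with W |= r = r' pairwise and
   W |= omega(r, ..., r) = r: on the first coordinate it satisfies Sigma because A
   satisfies Sigma^p, and its second coordinate is a single idempotent of G.
   Hence F is in V o W, and H(V o W) is the class of models of Sigma^p. *)
Require Import Defs.
From mathcomp Require Import all_boot boolp classical_sets.

Set Implicit Arguments.
Unset Strict Implicit.
Unset Printing Implicit Defensive.

Lemma sval_inj (T : Type) (P : T -> Prop) : injective (@sval T P).
Proof. by move=> a b; apply: eq_sig_hprop => ? ? ?; apply: Prop_irrelevance. Qed.

(** * Evaluation of terms, and preservation of identities under images, subalgebras and products *)

Section Identities.
Variables (Om : Type) (tau : Om -> nat).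
Implicit Types (A B : algebra tau) (t : term tau) (e : identity tau).

Lemma eval_hom A B (f : A -> B) (h : nat -> A) t :
  hom f -> f (eval h t) = eval (f \o h) t.
Proof.
move=> homf; elim: t => //= o a IH.
by rewrite homf; congr op; apply: funext => j /=; rewrite IH.
Qed.

Lemma eval_subst A (h : nat -> A) (r : nat -> term tau) t :
  eval h (subst r t) = eval (fun i => eval h (r i)) t.
Proof. by elim: t => //= o a IH; congr op; apply: funext. Qed.

Lemma eval_vars_below A (h h' : nat -> A) k t :
  vars_below k t -> (forall i, (i < k)%N -> h i = h' i) ->
  eval h t = eval h' t.
Proof.
move=> + hh'; elim: t => /= [i /hh' // | o a IH below].
by congr op; apply: funext => j; apply: IH.
Qed.

Lemma eval_idempotent A (x : A) t :
  (forall o, op A o (fun=> x) = x) -> eval (fun=> x) t = x.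
Proof.
move=> idem; elim: t => //= o a IH.
by rewrite -[RHS](idem o); congr op; apply: funext.
Qed.

Lemma vars_below_leq k k' t :
  (k <= k')%N -> vars_below k t -> vars_below k' t.
Proof.
move=> kk'; elim: t => /= [i ik | o a IH below j]; first exact: leq_trans kk'.
exact: IH.
Qed.

Lemma vars_below_exists t : exists k, vars_below k t.
Proof.
elim: t => [i | o a /choice[k kP]]; first by exists i.+1 => /=.
exists (\max_j k j) => j; apply: vars_below_leq (kP j).
exact: leq_bigmax.
Qed.

Lemma vars_below_gt0 k t :
  (forall o, (0 < tau o)%N) -> vars_below k t -> (0 < k)%N.
Proof.
move=> tau_gt0; elim: t => /= [i | o a IH below]; first exact: leq_ltn_trans.
exact: IH (below (Ordinal (tau_gt0 o))).
Qed.

Lemma sval_hom A (S : set A) (subS : is_subalgebra S) :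
  hom (fun x : subalgebra subS => sval x : A).
Proof. by []. Qed.

Lemma satisfies_image A B (f : A -> B) e :
  hom f -> surjective f -> satisfies A e -> satisfies B e.
Proof.
move=> homf /choice[g fg] sat h.
have -> : h = f \o (g \o h) by apply: funext => i /=; rewrite fg.
by rewrite -!(eval_hom _ _ homf) sat.
Qed.

Lemma satisfies_subalgebra A (S : set A) (subS : is_subalgebra S) e :
  satisfies A e -> satisfies (subalgebra subS) e.
Proof.
by move=> sat h; apply: sval_inj; rewrite !(eval_hom _ _ (@sval_hom _ _ subS)).
Qed.

Lemma satisfies_product (I : Type) (A : I -> algebra tau) e :
  (forall i, satisfies (A i) e) -> satisfies (product A) e.
Proof.
move=> sat h; apply: functional_extensionality_dep => i.
have homi : hom (fun x : product A => x i) by [].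
by rewrite !(eval_hom _ _ homi); apply: sat.
Qed.

Lemma equational_base_variety (E : set (identity tau)) (K : algebra_class tau) :
  equational_base E K -> is_variety K.
Proof.
move=> base; split=> [A [B /base KB [f [homf surjf]]] | A S subS /base KA | I A KA];
  apply/base => e Ee.
- exact: satisfies_image (KB e Ee).
- exact/satisfies_subalgebra/KA.
- by apply: satisfies_product => i; move/base: (KA i); apply.
Qed.

Lemma image_subalgebra A B (f : A -> B) :
  hom f -> is_subalgebra [set y | exists x, f x = y]%classic.
Proof.
move=> homf; split=> [|o a /choice[b fb]].
  by case: (carrier_nonempty A) => x; exists (f x), x.
by exists (op A o b); rewrite homf; congr op; apply: funext => i /=.
Qed.

(* The map from the image of [f] to the quotient sends [f x] to the class of x. *)
Lemma variety_quotient (W : algebra_class tau) A B (f : A -> B)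
    (theta : congruence A) :
  is_variety W -> W B -> hom f -> (forall x y, f x = f y -> theta x y) ->
  W (quotient theta).
Proof.
move=> varW WB homf ker_f.
have subf := image_subalgebra homf.
have /choice[g fg] : forall y : subalgebra subf, exists x, f x = sval y.
  by case=> y /= [x <-]; exists x.
apply: (variety_H varW); exists (subalgebra subf).
  exact: (variety_S varW).
exists (fun y => quotient_proj theta (g y)); split=> [o a | q].
  rewrite (_ : _ \o a = quotient_proj theta \o (g \o a)) //.
  (* [g] is a mere choice of preimages, not a homomorphism; its defect is invisible to [f], hence
     absorbed by [theta]. *)
  rewrite -quotient_proj_hom; apply/quotient_projP/ker_f.
  by rewrite fg homf /=; congr op; apply: funext => i /=; rewrite fg.
have [x <-] := quotient_proj_surj q.
have fx : exists x', f x' = f x by exists x.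
exists (exist (fun y => exists x', f x' = y) (f x) fx).
by apply/quotient_projP/ker_f; rewrite fg.
Qed.

End Identities.

(** * Absolutely free algebras on arbitrary sets, and their passage to terms in numbered
    variables *)

Section FreeAlgebra.
Variables (Om : Type) (tau : Om -> nat).

(** The variables form any type, because the proof needs one variable per element of an algebra of
    any size, while [term] has only countably many. *)
Inductive free_term (X : Type) : Type :=
| FVar of X
| FApp (o : Om) of ('I_(tau o) -> free_term X).

Definition free_algebra (X : Type) (X0 : inhabited X) : algebra tau :=
  @Algebra Om tau (free_term X) (@FApp X)
    (let: inhabits x := X0 in inhabits (FVar x)).

Fixpoint free_eval (X : Type) (A : algebra tau) (h : X -> A) (t : free_term X) : A :=
  match t with
  | FVar x => h x
  | FApp o a => op A o (fun j => free_eval h (a j))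
  end.

Fixpoint number_vars (X : Type) (m : X -> nat) (t : free_term X) : term tau :=
  match t with
  | FVar x => Var (m x)
  | FApp o a => App o (fun j => number_vars m (a j))
  end.

Lemma eval_number_vars (X : Type) (m : X -> nat) (A : algebra tau)
    (h : nat -> A) (t : free_term X) :
  eval h (number_vars m t) = free_eval (h \o m) t.
Proof. by elim: t => //= o a IH; congr op; apply: funext. Qed.

(** Lists over [{classic X}] have decidable membership, so that a variable can be numbered by its
    [index]. *)
Fixpoint vars_in (X : Type) (l : seq {classic X}) (t : free_term X) : Prop :=
  match t with
  | FVar x => (x : {classic X}) \in l
  | FApp o a => forall j, vars_in l (a j)
  end.

Lemma vars_in_sub (X : Type) (l l' : seq {classic X}) (t : free_term X) :
  {subset l <= l'} -> vars_in l t -> vars_in l' t.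
Proof.
move=> ll'; elim: t => /= [x /ll' // | o a IH inl j].
exact: IH.
Qed.

Lemma vars_in_family (X : Type) k (t : 'I_k -> free_term X) :
  (forall i, exists l, vars_in l (t i)) -> exists l, forall i, vars_in l (t i).
Proof.
move=> /choice[l lP]; exists (flatten [seq l i | i <- enum 'I_k]) => i.
apply: vars_in_sub (lP i) => x xl; apply/flatten_mapP; exists i => //.
by rewrite mem_enum.
Qed.

Lemma vars_in_exists (X : Type) (t : free_term X) : exists l, vars_in l t.
Proof.
elim: t => [x | o a IH]; first by exists [:: x : {classic X}]; rewrite /= inE.
exact: vars_in_family.
Qed.

Lemma free_eval_eq_vars (X : Type) (A : algebra tau) (h h' : X -> A)
    (l : seq {classic X}) (t : free_term X) :
  vars_in l t -> (forall x : {classic X}, x \in l -> h x = h' x) ->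
  free_eval h t = free_eval h' t.
Proof.
move=> + hh'; elim: t => /= [x /hh' // | o a IH inl].
by congr op; apply: funext => j; apply: IH.
Qed.

(* Finitely many terms involve finitely many variables, which can be numbered. *)
Lemma number_vars_free_eval (A : algebra tau) k (t : nat -> free_term A) :
  exists (m : A -> nat) (h : nat -> A),
    forall i, (i < k)%N -> eval h (number_vars m (t i)) = free_eval id (t i).
Proof.
have [l lP] := @vars_in_family A k (t \o val) (fun=> vars_in_exists _).
have [x0] := carrier_nonempty A.
exists (fun x => index (x : {classic A}) l), (nth (x0 : {classic A}) l) => i ik.
rewrite eval_number_vars; apply: (free_eval_eq_vars (lP (Ordinal ik))) => x xl /=.
exact: (@nth_index {classic A} _ x l xl).
Qed.

(** For a variety [W], this is equality in the [W]-free algebra on [X], kept as a relation on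
    terms. *)
Definition class_equal (X : Type) (W : algebra_class tau) (s t : free_term X) :
    Prop :=
  forall (B : algebra tau), W B -> forall h : X -> B, free_eval h s = free_eval h t.

Lemma class_equal_number_vars (X : Type) (W : algebra_class tau)
    (m : X -> nat) (s t : free_term X) :
  class_equal W s t ->
  class_satisfies W (Identity (number_vars m s) (number_vars m t)).
Proof. by move=> st B WB h; rewrite /= !eval_number_vars; apply: st. Qed.

(* G is a product of algebras of W, one refuting each equation that fails in W. *)
Lemma class_equal_kernel (X : Type) (X0 : inhabited X) (W : algebra_class tau) :
  is_variety W ->
  exists (G : algebra tau) (g : free_algebra X0 -> G),
    [/\ W G, hom g & forall s t, g s = g t -> class_equal W s t].
Proof.
move=> varW.
pose I := {st : free_term X * free_term X | ~ class_equal W st.1 st.2}.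
have /choice[Bh BhP] (i : I) : exists Bh : {B : algebra tau & X -> B},
    W (projT1 Bh) /\
    free_eval (projT2 Bh) (sval i).1 <> free_eval (projT2 Bh) (sval i).2.
  case: i => -[s t] /= nst; apply: contrapT => noBh; apply: nst => B WB h.
  by apply: contrapT => ne; apply: noBh; exists (existT _ B h).
exists (product (fun i => projT1 (Bh i))), (fun t i => free_eval (projT2 (Bh i)) t).
split=> // [|s t st].
  by apply: (variety_P varW) => i; case: (BhP i).
apply: contrapT => nst; have [_] := BhP (exist _ (s, t) nst).
by apply; apply: (congr1 (fun f => f (exist _ (s, t) nst)) st).
Qed.

End FreeAlgebra.

(** * The two inclusions between H(V o W) and the class of models of Sigma^p *)

Section MaltsevProduct.
Variables (Om : Type) (tau : Om -> nat).

Definition pair_algebra (A B : algebra tau) : algebra tau :=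
  @Algebra Om tau (A * B)%type
    (fun o a => (op A o (fun i => (a i).1), op B o (fun i => (a i).2)))
    (let: inhabits x := carrier_nonempty A in
     let: inhabits y := carrier_nonempty B in inhabits (x, y)).

(** Kept transparent, so that membership in a class unfolds to an equation between images under
    [f]. *)
Definition kernel (A B : algebra tau) (f : A -> B) (homf : hom f) :
  congruence A.
Proof.
apply: (@Congruence Om tau A (fun x y => f x = f y)) => // [x y z -> // | o a b ab].
by rewrite !homf; congr op; apply: funext.
Defined.

Variables (V W : algebra_class tau) (Sigma : set (identity tau)).
Hypothesis tau_gt0 : forall o : Om, (0 < tau o)%N.
Hypothesis varW : is_variety W.
Hypothesis baseV : equational_base Sigma V.

(** The values of r_1, ..., r_k lie in one class of [theta]. That class is a subalgebra because r_1
    is idempotent modulo W, so it belongs to V and satisfies u = v. *)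
Lemma maltsev_product_identities_p (B : algebra tau) e :
  maltsev_product V W B -> identities_p W Sigma e -> satisfies B e.
Proof.
case=> theta [WQ Vclass] [[u v] Ss [k [r [[/= ub vb] rW idemW ->]]]] h.
rewrite /= !eval_subst.
have k_gt0 := vars_below_gt0 tau_gt0 ub.
have thetaP (s t : term tau) : class_satisfies W (Identity s t) ->
    (* The quotient lies in W, so every identity of W holds in [B] up to [theta]. *)
    theta (eval h s) (eval h t).
  move=> /(_ _ WQ (quotient_proj theta \o h)) /=.
  rewrite -!(eval_hom _ _ (@quotient_proj_hom _ _ _ theta)).
  by move/quotient_projP.
pose x := eval h (r 0).
have subC : is_subalgebra [set y | theta x y]%classic.
  split=> [|o a xa]; first by exists x; apply: cong_refl.
  apply: cong_trans (cong_op xa).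
  exact: cong_sym (thetaP _ _ (idemW o)).
(* The default [x] keeps the whole assignment inside the class; [u] and [v] only read the indices
   below [k]. *)
pose y i := if (i < k)%N then eval h (r i) else x.
have xy i : theta x (y i).
  rewrite /y; case: ifP => [ik | _]; last exact: cong_refl.
  exact/thetaP/rW.
have /baseV/(_ _ Ss)/(_ (fun i => exist _ (y i) (xy i))) := Vclass x subC.
move=> /(congr1 sval) /=; rewrite !(eval_hom _ _ (@sval_hom _ _ _ _ subC)).
have yr i : (i < k)%N -> y i = eval h (r i) by rewrite /y => ->.
by rewrite (eval_vars_below ub yr) (eval_vars_below vb yr).
Qed.

Lemma identities_p_hom_images (A : algebra tau) :
  (forall e, identities_p W Sigma e -> satisfies A e) ->
  hom_images (maltsev_product V W) A.
Proof.
move=> satA.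
have [G [g [WG homg kerg]]] := class_equal_kernel (carrier_nonempty A) varW.
pose f (t : free_algebra tau (carrier_nonempty A)) : pair_algebra A G :=
  (free_eval id t, g t).
have homf : hom f by move=> o a; rewrite /f homg.
pose F := subalgebra (image_subalgebra homf).
pose p1 (y : F) : A := (sval y).1.
pose p2 (y : F) : G := (sval y).2.
have hom1 : hom p1 by [].
have hom2 : hom p2 by [].
exists F; last first.
  exists p1; split=> // x.
  (* The variable [x] evaluates to the element [x], so the first projection is onto. *)
  have fx : exists t, f t = f (FVar tau x) by exists (FVar tau x).
  by exists (exist (fun y => exists t, f t = y) _ fx).
exists (kernel hom2); split; first exact: (variety_quotient varW WG hom2).
move=> x subC; apply/baseV => -[u v] Ss h /=.
pose y i : F := sval (h i).
have /choice[t ft] i : exists t, f t = sval (y i) by exact: (svalP (y i)).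
have gt i : g (t i) = p2 x by rewrite [RHS](svalP (h i)) /p2 -ft.
(* The class of [x] is closed under [o]; apply this to the constant family [x]. *)
have idem o : op G o (fun=> p2 x) = p2 x.
  exact: esym (@subalgebra_op _ _ _ _ subC o (fun=> x) (fun=> erefl)).
have [ku uku] := vars_below_exists u; have [kv vkv] := vars_below_exists v.
pose k := maxn ku kv.
have ub : vars_below k u by apply: vars_below_leq uku; apply: leq_maxl.
have vb : vars_below k v by apply: vars_below_leq vkv; apply: leq_maxr.
have [m [e eP]] := number_vars_free_eval k t.
pose r i := number_vars m (t i).
have eqA : eval (p1 \o y) u = eval (p1 \o y) v.
  have ry i : (i < k)%N -> eval e (r i) = (p1 \o y) i.
    by move=> ik; rewrite eP //= /p1 -ft.
  rewrite -(eval_vars_below ub ry) -(eval_vars_below vb ry) -!eval_subst.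
  apply: (satA (Identity (subst r u) (subst r v))); exists (Identity u v) => //.
  (* All [t i] have the same image [p2 x] under [g], and [g] identifies only terms that are equal
     throughout W. *)
  exists k, r; split=> // [i j _ _ | o].
    by apply: class_equal_number_vars; apply: kerg; rewrite !gt.
  (* Numbering the variables of this free term yields [App o (fun=> r 0)]. *)
  apply: (@class_equal_number_vars _ _ _ _ _ (FApp (fun=> t 0))).
  apply: kerg; rewrite (homg o (fun=> t 0)) gt -[RHS](idem o).
  by congr op; apply: funext => j /=; rewrite gt.
have eqG : eval (p2 \o y) u = eval (p2 \o y) v.
  have -> : p2 \o y = fun=> p2 x by apply: funext => i; rewrite -(gt i) /p2 /= -ft.
  by rewrite !eval_idempotent.
apply: sval_inj; rewrite !(eval_hom _ _ (@sval_hom _ _ _ _ subC)).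
apply: sval_inj; rewrite [LHS]surjective_pairing [RHS]surjective_pairing.
move: eqA eqG; rewrite -!(eval_hom _ _ hom1) -!(eval_hom _ _ hom2) => eqA eqG.
exact: congr2 eqA eqG.
Qed.

End MaltsevProduct.

Theorem theorem2p10 (Om : Type) (tau : Om -> nat)
    (tau_gt0 : forall o : Om, (0 < tau o)%N)
    (V W : algebra_class tau) (varV : is_variety V) (varW : is_variety W)
    (Sigma : set (identity tau)) (baseV : equational_base Sigma V) :
  (forall A : algebra tau,
     hom_images (maltsev_product V W) A <->
     generated_variety (maltsev_product V W) A) /\
  equational_base (identities_p W Sigma) (hom_images (maltsev_product V W)).
Proof.
have base : equational_base (identities_p W Sigma)
    (hom_images (maltsev_product V W)).
  move=> A; split=> [[B VWB [f [homf surjf]]] e Ee |].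
    apply: satisfies_image homf surjf _.
    exact: (maltsev_product_identities_p tau_gt0 baseV VWB Ee).
  exact: identities_p_hom_images.
split=> // A; split=> [[B VWB homB] U varU VWU | ].
  by apply: (variety_H varU); exists B => //; apply: VWU.
(* Being defined by identities, H(V o W) is itself a variety, so it can be taken as [U]. *)
apply; first exact: equational_base_variety base.
by move=> B VWB; exists B => //; exists id; split=> // x; exists x.
Qed.
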